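(* Let $n\ge 2$, $m=2$. Let $0<\underline a\le\bar a<\infty$, $d^0\in\mathbb{R}^n$ with $d_i^0\in[\underline a,\bar a]$ for all $i\in[n]$, $\alpha>0$, $\bar d_i=\alpha d_i^0$ for $i\in[n]$, $0\le\Gamma\le n$ (real), and $$U=\left\{d\in\mathbb{R}^n:\ d_i=d_i^0+\bar d_iu_i,\ u_i\in[0,1]\ (i\in[n]),\ \sum_{i=1}^nu_i\le\Gamma\right\}.$$ Let $\mathrm{RH}$ be the worst-case makespan over $d\in U$ of any scheduling policy for $n$ tasks on two identical machines that never leaves a machine idle while there are unstarted tasks (in particular, of a rolling-horizon implementation of a scheduling policy), and let $\mathrm{PH}$ be the worst-case makespan over $d\in U$ of the perfect hindsight policy. Then $$\frac{\mathrm{RH}}{\mathrm{PH}}\ \le\ 1+\frac{\bar a\,\min\{1+\alpha,\ 1+\alpha\Gamma\}}{\underline a\,(n+\alpha\Gamma)}.$$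
   Context: Notation: $[n]=\{1,\dots,n\}$ and $e\in\mathbb{R}^n$ is the all-ones vector. There are $n$ tasks to be processed on $m=2$ identical machines, all available at time $0$, without precedence relations or preemption. The durations $d=(d_1,\dots,d_n)$ are uncertain and lie in $U$ (a budgeted uncertainty set with nominal durations $d^0$, maximal perturbations $\bar d$ and budget $\Gamma$). Perfect hindsight: the allocation of tasks to machines is chosen optimally knowing $d$, so $$\mathrm{PH}=\sup_{d\in U}\ \min_{x\in\{0,1\}^n}\ \max\{x^\top d,(e-x)^\top d\},$$ where $x_i=1$ if task $i$ is on machine 1 and $x_i=0$ if it is on machine 2. RH policies: a scheduling policy selects, each time a machine is idle and unstarted tasks remain, an unstarted task, which is immediately started on the idle machine (so no machine is ever idle while an unstarted task exists). The selection may depend in any way on the information observed so far (order of started tasks, completed tasks and their durations, running tasks and their elapsed processing times). A rolling-horizon implementation re-optimizes the policy each time a machine becomes idle and executes only the immediate decision. For such a policy and $d\in U$, the makespan is the time at which all tasks are completed, i.e. the maximum over the two machines of the sum of the durations of the tasks processed on it; RH is the supremum of this makespan over $d\in U$. *)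

(* Defs.v *)
From HB Require Import structures.
From mathcomp Require Import all_boot all_order all_algebra.
From mathcomp Require Import classical_sets reals.
Set Implicit Arguments.
Unset Strict Implicit.
Unset Printing Implicit Defensive.
Import Order.TTheory GRing.Theory Num.Theory.
Local Open Scope classical_set_scope.
Local Open Scope ring_scope.

Definition budgeted_set (R : realType) (n : nat) (d0 dbar : 'rV[R]_n)
    (Gamma : R) : set 'rV[R]_n :=
  [set d | exists u : 'rV[R]_n,
     [/\ forall i, 0 <= u 0 i <= 1,
         \sum_(i < n) u 0 i <= Gamma
       & forall i, d 0 i = d0 0 i + dbar 0 i * u 0 i]].

(* x i = true iff task i is on machine 1: this is max{x^T d, (e - x)^T d}. *)
Definition alloc_makespan (R : realType) (n : nat) (d : 'rV[R]_n)
    (x : {ffun 'I_n -> bool}) : R :=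
  Num.max (\sum_(i < n) (x i)%:R * d 0 i)
          (\sum_(i < n) (1 - (x i)%:R) * d 0 i).

(* The minimum over all allocations; the seed of the iterated minimum is the
   value of an actual allocation, so it does not affect the result. *)
Definition opt_makespan (R : realType) (n : nat) (d : 'rV[R]_n) : R :=
  \big[Num.min/alloc_makespan d [ffun=> true]]_(x : {ffun 'I_n -> bool})
    alloc_makespan d x.

Definition PH (R : realType) (n : nat) (U : set 'rV[R]_n) : R :=
  sup [set opt_makespan d | d in U].

(* What is known about a started task: its duration if it is completed, its
   elapsed processing time if it is still running. *)
Inductive status (R : Type) : Type :=
| Completed of R
| Running of R.

(* The started tasks in the order in which they were started, each with its
   machine (true is machine 1, false is machine 2) and its status.  Start
   times, the current time and all earlier observations can be recovered from
   this, so a function of the latest observation is a function of the whole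
   observed history. *)
Definition observation (R : Type) (n : nat) : Type :=
  seq ('I_n * bool * status R).

Definition observed_tasks (R : Type) (n : nat) (o : observation R n) :
    seq 'I_n :=
  [seq e.1.1 | e <- o].

Definition policy (R : Type) (n : nat) : Type := observation R n -> 'I_n.

Definition admissible (R : Type) (n : nat) (pol : policy R n) : Prop :=
  forall o : observation R n,
    (exists i : 'I_n, i \notin observed_tasks o) ->
    pol o \notin observed_tasks o.

(* The pairs (task, machine) in the order in which the tasks were started. *)
Definition schedule (n : nat) : Type := seq ('I_n * bool).

Definition load (R : realType) (n : nat) (d : 'rV[R]_n) (s : schedule n)
    (k : bool) : R :=
  \sum_(p <- s | p.2 == k) d 0 p.1.

(* As no machine idles while unstarted tasks remain, machine k becomes idle at
   time load d s k; the next decision is taken when the first machine does. *)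
Definition decision_time (R : realType) (n : nat) (d : 'rV[R]_n)
    (s : schedule n) : R :=
  Num.min (load d s true) (load d s false).

(* If both machines are idle, the next task goes to machine 1; as the machines
   are identical, this only fixes their labels. *)
Definition idle_machine (R : realType) (n : nat) (d : 'rV[R]_n)
    (s : schedule n) : bool :=
  load d s true <= load d s false.

(* past lists the tasks started before p, so p starts at load d past p.2. *)
Definition task_status (R : realType) (n : nat) (d : 'rV[R]_n) (now : R)
    (past : schedule n) (p : 'I_n * bool) : status R :=
  let start := load d past p.2 in
  if start + d 0 p.1 <= now then Completed (d 0 p.1) else Running (now - start).

Fixpoint observe_from (R : realType) (n : nat) (d : 'rV[R]_n) (now : R)
    (past s : schedule n) : observation R n :=
  if s is p :: s' then
    (p, task_status d now past p) :: observe_from d now (rcons past p) s'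
  else [::].

Definition observe (R : realType) (n : nat) (d : 'rV[R]_n) (s : schedule n) :
    observation R n :=
  observe_from d (decision_time d s) [::] s.

(* The durations d are accessible to the policy only through observe. *)
Definition start_next (R : realType) (n : nat) (pol : policy R n)
    (d : 'rV[R]_n) (s : schedule n) : schedule n :=
  rcons s (pol (observe d s), idle_machine d s).

Definition run (R : realType) (n : nat) (pol : policy R n) (d : 'rV[R]_n) :
    schedule n :=
  iter n (start_next pol d) [::].

Definition makespan (R : realType) (n : nat) (pol : policy R n)
    (d : 'rV[R]_n) : R :=
  Num.max (load d (run pol d) true) (load d (run pol d) false).

Definition RH (R : realType) (n : nat) (pol : policy R n)
    (U : set 'rV[R]_n) : R :=
  sup [set makespan pol d | d in U].

(* Main.v *)
Require Import Defs.
From HB Require Import structures.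
From mathcomp Require Import all_boot all_order all_algebra.
From mathcomp Require Import classical_sets reals.
From mathcomp Require Import lra.
Set Implicit Arguments.
Unset Strict Implicit.
Unset Printing Implicit Defensive.
Import Order.TTheory GRing.Theory Num.Theory.
Local Open Scope ring_scope.

(** Write S(d) for the total duration of the tasks.  Everything rests on two
bounds that hold for each fixed d.

No allocation beats S(d)/2, since the two machine loads sum to S(d); so
S(d)/2 <= [opt_makespan d] ([half_total_le_opt_makespan]).

A policy that never idles always gives the next task to the less loaded
machine, so the gap between the two loads never exceeds the longest task
([load_gap_le]).  Hence, if M bounds the durations, the final larger load is
at most (S(d) + M)/2 ([makespan_le]), whatever the policy does.

Together, the makespan under d is at most [opt_makespan d] + M/2, hence at most
PH + M/2.  Over the budgeted set, M can be taken to be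
amax * min(1 + alpha, 1 + alpha * Gamma), because a single perturbation can
exceed neither 1 nor the whole budget ([budgeted_set_le]).  It follows that
RH <= PH + M/2.  Finally, spreading the budget evenly over the tasks gives a
scenario of total duration at least amin * (n + alpha * Gamma), so PH is at
least half of that, and dividing by PH gives the ratio. *)

Section OptMakespan.
Variables (R : realType) (n : nat) (d : 'rV[R]_n).

Lemma half_total_le_alloc_makespan (x : {ffun 'I_n -> bool}) :
  (\sum_(i < n) d 0 i) / 2 <= alloc_makespan d x.
Proof.
rewrite /alloc_makespan.
set A := (X in Num.max X _); set B := (X in Num.max _ X).
have -> : \sum_(i < n) d 0 i = A + B.
  by rewrite -big_split; apply: eq_bigr => i _ /=; rewrite -mulrDl subrKC mul1r.
by rewrite le_max; case: (lerP A B) => ?; apply/orP; [right|left]; lra.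
Qed.

Lemma half_total_le_opt_makespan :
  (\sum_(i < n) d 0 i) / 2 <= opt_makespan d.
Proof.
by apply/bigmin_geP; split=> [|x _]; apply: half_total_le_alloc_makespan.
Qed.

Lemma opt_makespan_le_total :
  (forall i, 0 <= d 0 i) -> opt_makespan d <= \sum_(i < n) d 0 i.
Proof.
move=> d_ge0; apply: (le_trans (bigmin_le_id _ _ _ _)).
rewrite /alloc_makespan ge_max; apply/andP; split; apply: ler_sum => i _.
  by rewrite ffunE mul1r.
by rewrite ffunE subrr mul0r.
Qed.

End OptMakespan.

Section Run.
Variables (R : realType) (n : nat) (pol : policy R n) (d : 'rV[R]_n).

Lemma observed_tasks_observe (s : schedule n) :
  observed_tasks (observe d s) = [seq p.1 | p <- s].
Proof.
rewrite /observe; move: (decision_time d s) => now.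
by elim: s [::] => //= p s IHs past; congr (_ :: _); apply: IHs.
Qed.

Lemma uniq_iter_start_next (k : nat) : admissible pol -> (k <= n)%N ->
  uniq [seq p.1 | p <- iter k (start_next pol d) [::]].
Proof.
move=> adm; elim: k => //= k IHk k_lt_n.
set s := iter k _ _ in IHk *.
rewrite map_rcons rcons_uniq IHk 1?ltnW // andbT -observed_tasks_observe.
apply: adm; rewrite observed_tasks_observe.
(* Only k < n tasks have been started, so one remains. *)
have size_s : size [seq p.1 | p <- s] = k.
  by rewrite size_map /s; elim: (k) => //= j; rewrite size_rcons => ->.
apply/existsP; apply: contraLR k_lt_n; rewrite negb_exists => /forallP all_started.
rewrite -leqNgt -[X in (X <= _)%N]card_ord -size_s.
apply: leq_trans (card_size _); apply/eq_leq/eq_card => i.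
by rewrite -[RHS]negbK all_started.
Qed.

Lemma load_rcons (s : schedule n) p k :
  load d (rcons s p) k = load d s k + (if p.2 == k then d 0 p.1 else 0).
Proof. by rewrite /load big_rcons /=; case: ifP; rewrite ?addr0 // addrC. Qed.

Lemma load_add_le_total (s : schedule n) : (forall i, 0 <= d 0 i) ->
  uniq [seq p.1 | p <- s] ->
  load d s true + load d s false <= \sum_(i < n) d 0 i.
Proof.
move=> d_ge0 uniq_s.
have -> : load d s true + load d s false = \sum_(p <- s) d 0 p.1.
  rewrite (bigID (fun p => p.2 == true)) /=; congr (_ + _).
  by apply: eq_bigl => -[? []].
rewrite -(big_map fst xpredT (fun i => d 0 i)) big_uniq //.
rewrite [leRHS](bigID [in [seq p.1 | p <- s]]) /= lerDl.
exact: sumr_ge0.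
Qed.

(** The less loaded machine receives the next task: it either catches up in
part, or overtakes the other machine by at most the length of that task. *)
Lemma load_gap_le (M : R) (k : nat) : 0 <= M ->
  (forall i, 0 <= d 0 i <= M) ->
  let s := iter k (start_next pol d) [::] in
  `|load d s true - load d s false| <= M.
Proof.
move=> M_ge0 d_le; elim: k => [|k /=].
  by rewrite /load /= !big_nil subrr normr0.
set s := iter k _ _; rewrite /start_next !load_rcons /= /idle_machine.
have /andP[] := d_le (pol (observe d s)).
by rewrite !ler_norml; case: (lerP (load d s true) (load d s false)) => /=; lra.
Qed.

Lemma makespan_le (M : R) : admissible pol -> 0 <= M ->
  (forall i, 0 <= d 0 i <= M) ->
  makespan pol d <= (\sum_(i < n) d 0 i + M) / 2.
Proof.
move=> adm M_ge0 d_le.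
have d_ge0 i : 0 <= d 0 i by case/andP: (d_le i).
have := load_gap_le n M_ge0 d_le.
have := load_add_le_total d_ge0 (uniq_iter_start_next adm (leqnn n)).
rewrite /makespan /run /= ler_norml ge_max.
by move=> ? /andP[? ?]; apply/andP; split; lra.
Qed.

End Run.

Section Budget.
Variables (R : realType) (n : nat) (d0 : 'rV[R]_n) (alpha Gamma : R).
Hypotheses (d0_ge0 : forall i, 0 <= d0 0 i) (alpha_ge0 : 0 <= alpha).

(** As perturbations are nonnegative, each of them is bounded by the whole
budget, and not only by 1. *)
Lemma budgeted_set_le (amax : R) (d : 'rV[R]_n) :
  (forall i, d0 0 i <= amax) -> budgeted_set d0 (alpha *: d0) Gamma d ->
  forall i, 0 <= d 0 i <= amax * Num.min (1 + alpha) (1 + alpha * Gamma).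
Proof.
move=> d0_le [u [u01 sum_u dE]] i; rewrite dE mxE.
have /andP[ui_ge0 ui_le1] := u01 i.
have ui_leGamma : u 0 i <= Gamma.
  apply: le_trans sum_u; rewrite (bigD1 i) //= lerDl.
  by apply: sumr_ge0 => j _; case/andP: (u01 j).
have -> : d0 0 i + alpha * d0 0 i * u 0 i = d0 0 i * (1 + alpha * u 0 i).
  by rewrite mulrDr mulr1 mulrA [alpha * _]mulrC.
have au_ge0 : 0 <= 1 + alpha * u 0 i by rewrite addr_ge0 ?mulr_ge0.
rewrite mulr_ge0 //= ler_pM // le_min !lerD2l; apply/andP; split.
  by rewrite ler_piMr.
by rewrite ler_wpM2l.
Qed.

Lemma budgeted_set_even : (0 < n)%N -> 0 <= Gamma <= n%:R ->
  budgeted_set d0 (alpha *: d0) Gamma ((1 + alpha * (Gamma / n%:R)) *: d0).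
Proof.
move=> n_gt0 /andP[Gamma_ge0 Gamma_le].
have n_gt0R : 0 < n%:R :> R by rewrite ltr0n.
exists (const_mx (Gamma / n%:R)); split=> [i||i]; rewrite ?mxE.
- by rewrite divr_ge0 ?ler0n //= ler_pdivrMr // mul1r.
- under eq_bigr do rewrite mxE.
  by rewrite sumr_const card_ord -[leLHS]mulr_natr divfK ?gt_eqF.
- by rewrite mulrDl mul1r mulrAC.
Qed.

End Budget.

Theorem theorem2 (R : realType) (n : nat) (hn : (2 <= n)%N)
    (amin amax : R) (hamin : 0 < amin) (hamax : amin <= amax)
    (d0 : 'rV[R]_n) (hd0 : forall i : 'I_n, amin <= d0 0 i <= amax)
    (alpha : R) (halpha : 0 < alpha)
    (Gamma : R) (hGamma : 0 <= Gamma <= n%:R)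
    (pol : policy R n) (hpol : admissible pol) :
  let U := budgeted_set d0 (alpha *: d0) Gamma in
  RH pol U / PH U <=
    1 + amax * Num.min (1 + alpha) (1 + alpha * Gamma)
        / (amin * (n%:R + alpha * Gamma)).
Proof.
set U := budgeted_set _ _ _; set M := amax * _; set L := amin * _ => /=.
have n_gt0 : (0 < n)%N by apply: leq_trans hn.
have n_gt0R : 0 < n%:R :> R by rewrite ltr0n.
have /andP[Gamma_ge0 Gamma_le] := hGamma.
have d0_ge i : amin <= d0 0 i by case/andP: (hd0 i).
have d0_le i : d0 0 i <= amax by case/andP: (hd0 i).
have d0_ge0 i : 0 <= d0 0 i by apply: le_trans (d0_ge i); apply: ltW.
have L_gt0 : 0 < L by rewrite mulr_gt0 // ltr_wpDr // mulr_ge0 // ltW.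
have M_ge0 : 0 <= M.
  apply: mulr_ge0; first exact: le_trans (ltW hamin) hamax.
  by rewrite le_min !addr_ge0 ?mulr_ge0 // ltW.
have U_le d : U d -> forall i, 0 <= d 0 i <= M.
  exact: (budgeted_set_le d0_ge0 (ltW halpha) d0_le).
have U_even := budgeted_set_even d0 alpha n_gt0 hGamma.
have opt_le_PH d : U d -> opt_makespan d <= PH U.
  move=> Ud; apply: ub_le_sup; last by exists d.
  exists (n%:R * M) => _ [d' Ud' <-].
  have d'_le := U_le _ Ud'.
  apply: le_trans (opt_makespan_le_total _) _ => [i|].
    by case/andP: (d'_le i).
  have -> : n%:R * M = \sum_(i < n) M by rewrite sumr_const card_ord mulr_natl.
  apply: ler_sum => i _.
  by case/andP: (d'_le i).
have PH_ge : L / 2 <= PH U.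
  apply: le_trans (opt_le_PH _ U_even).
  apply: le_trans (half_total_le_opt_makespan _).
  rewrite ler_pM2r ?invr_gt0 //.
  have -> : L = \sum_(i < n) (1 + alpha * (Gamma / n%:R)) * amin.
    rewrite sumr_const card_ord -mulrnAl mulrC -mulr_natr; congr (_ * _).
    by rewrite mulrDl mul1r -mulrA divfK ?gt_eqF.
  apply: ler_sum => i _; rewrite mxE ler_wpM2l //.
  by rewrite addr_ge0 // mulr_ge0 ?divr_ge0 ?ler0n // ltW.
have RH_le : RH pol U <= PH U + M / 2.
  apply: ge_sup => [|_ [d Ud <-]].
    by apply: image_nonempty; eexists; exact: U_even.
  apply: le_trans (makespan_le hpol M_ge0 (U_le _ Ud)) _.
  rewrite mulrDl lerD2r; apply: le_trans (opt_le_PH _ Ud).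
  exact: half_total_le_opt_makespan.
have PH_gt0 : 0 < PH U by apply: lt_le_trans PH_ge; rewrite divr_gt0.
rewrite ler_pdivrMr // mulrDl mul1r (le_trans RH_le) // lerD2l.
by rewrite -[leRHS]mulrA ler_wpM2l // ler_pdivlMl.
Qed.
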